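(* Let $G$ be a Garside group and $x\in G$. For each pair $x_1,x_2\in C^*(x)$ there exists a finite sequence $$y_1=x_1,\ y_2,\ y_3,\ \dots,\ y_k=x_2$$ of elements of $C^*(x)$ such that, for each $i=1,\dots,k-1$, $y_{i+1}=y_i^{u_i}$ for some $u_i\in A(y_i)$.
   Context: Garside groups. A monoid $M$ is atomic if it is generated by its atoms (elements $x\ne1$ such that $x=yz$ implies $y=1$ or $z=1$) and every $x\in M$ has a finite norm $\|x\|$, the maximal number of factors in an expression of $x$ as a product of atoms. A Garside monoid is a cancellative atomic monoid $M$ in which any two elements have left and right greatest common divisors and left and right least common multiples, together with a Garside element $\Delta\in M$: its left divisors coincide with its right divisors, and they form a finite set $S$ (the simple elements) generating $M$. A Garside group $G$ is the group of fractions of a Garside monoid $M$. For $x,y\in G$, $x\prec y$ means $x^{-1}y\in M$ (a partial order on $G$), and $x\wedge y$, $x\vee y$ are the greatest lower bound and least upper bound with respect to $\prec$. Write $x^u=u^{-1}xu$. For $q\in\mathbb{Z}$ the cycling operation of order $q$ is $\mathrm{c}_q(x)=x^{x\wedge\Delta^q}$, and $G_q=\{x\in G\mid \mathrm{c}_q^N(x)=x\text{ for some }N>0\}$. With $C(x)$ the conjugacy class of $x$, the fully refined summit set is $C^*(x)=C(x)\cap\bigcap_{q\in\mathbb{Z}}G_q$. For $y\in G$, $A(y)$ denotes the set of $\prec$-minimal elements of $\{u\in S\setminus\{1\}\mid y^u\in C^*(y)\}$. *)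

(* Defs.v *)
From HB Require Import structures.
From mathcomp Require Import all_boot ssralg ssrint.
From mathcomp Require Import boolp classical_sets cardinality.

Set Implicit Arguments.
Unset Strict Implicit.
Unset Printing Implicit Defensive.

Local Open Scope classical_set_scope.
Local Open Scope group_scope.

Section Bounds.
Variables (T : Type) (R : T -> T -> Prop).

Definition is_glb (x y z : T) : Prop :=
  [/\ R z x, R z y & forall t, R t x -> R t y -> R t z].

Definition is_lub (x y z : T) : Prop :=
  [/\ R x z, R y z & forall t, R x t -> R y t -> R z t].

End Bounds.

Section GarsideMonoid.
Variable M : monoidType.
Implicit Types x y : M.

Definition ldivides x y : Prop := exists z, y = x * z.
Definition rdivides x y : Prop := exists z, y = z * x.

Definition atom x : Prop :=
  x <> 1 /\ forall y z, x = y * z -> y = 1 \/ z = 1.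

Definition generated_by (A : set M) : Prop :=
  forall x, exists2 s : seq M, (forall a, a \in s -> A a) & \prod_(a <- s) a = x.

Definition atom_word x (s : seq M) : Prop :=
  (forall a, a \in s -> atom a) /\ \prod_(a <- s) a = x.

Definition is_norm x (n : nat) : Prop :=
  (exists2 s, atom_word x s & size s = n) /\
  (forall s, atom_word x s -> (size s <= n)%N).

Definition atomic : Prop :=
  generated_by atom /\ forall x, exists n, is_norm x n.

Definition cancellative : Prop :=
  (forall x y z, x * y = x * z -> y = z) /\
  (forall x y z, y * x = z * x -> y = z).

Definition garside_element (Delta : M) : Prop :=
  [/\ forall x, ldivides x Delta <-> rdivides x Delta,
      finite_set [set x | ldivides x Delta] &
      generated_by [set x | ldivides x Delta]].

Record garside_monoid (Delta : M) : Prop := GarsideMonoid {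
  garside_cancellative : cancellative;
  garside_atomic : atomic;
  garside_lgcd : forall x y, exists z, is_glb ldivides x y z;
  garside_rgcd : forall x y, exists z, is_glb rdivides x y z;
  (* upper bounds for divisibility on the left are common right multiples,
     and conversely; both kinds of least common multiples are required *)
  garside_rlcm : forall x y, exists z, is_lub ldivides x y z;
  garside_llcm : forall x y, exists z, is_lub rdivides x y z;
  garside_delta : garside_element Delta }.

End GarsideMonoid.

(* Left fractions suffice: a Garside monoid has common multiples on both sides
   (the Ore condition), so these are exactly the right fractions as well. *)
Definition group_of_fractions (M : monoidType) (G : groupType)
    (iota : M -> G) : Prop :=
  [/\ monoid_morphism iota,
      injective iota &
      forall g, exists a b, g = (iota a)^-1 * iota b].

Definition expgz (G : groupType) (x : G) (q : int) : G :=
  match q with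
  | Posz n => x ^+ n
  | Negz n => x ^- n.+1
  end.

Section GarsideGroup.
Variables (M : monoidType) (G : groupType) (iota : M -> G) (Delta : M).
Implicit Types (x y u : G) (q : int).

Definition prec x y : Prop := range iota (x^-1 * y).

(* The greatest lower bound of x and y for prec; the default value 1 is never
   used when G is a Garside group, since prec is then a lattice order. *)
Definition gmeet x y : G := xget 1 [set z | is_glb prec x y z].

Definition simples : set G := iota @` [set a | ldivides a Delta].

Definition cycling q x : G := x ^ gmeet x (expgz (iota Delta) q).

Definition periodic q : set G :=
  [set x | exists2 N : nat, (0 < N)%N & iter N (cycling q) x = x].

Definition conj_class x : set G := [set y | exists u, y = x ^ u].

Definition Cstar x : set G := conj_class x `&` \bigcap_(q : int) periodic q.

Definition minimal_in (B : set G) : set G :=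
  [set u | B u /\ forall v, B v -> prec v u -> v = u].

Definition Amin y : set G :=
  minimal_in [set u | [/\ simples u, u <> 1 & Cstar y (y ^ u)]].

End GarsideGroup.

(* Main.v *)
Require Import Defs.
From mathcomp Require Import all_boot ssralg ssrint.
From mathcomp Require Import boolp classical_sets cardinality.

Set Implicit Arguments.
Unset Strict Implicit.
Unset Printing Implicit Defensive.

Local Open Scope group_scope.

(* Let y ^ u be a conjugate of y. Its transport under the cycling c_q is
   t(u) = (y /\ D^q)^-1 u (y ^ u /\ D^q) = (y /\ D^q)^-1 (y u /\ u D^q), which
   conjugates c_q(y) to c_q(y ^ u); the second form shows that t preserves meets
   and fixes every power of D. If y and y ^ u are both c_q-periodic, an iterated
   transport along a common period permutes the finite set of those v in
   [1, D^m] with y ^ v = y ^ u, so a further iterate fixes u. Hence, if y ^ u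
   and y ^ v lie in C*, some iterated transport fixes u, v, and therefore u /\ v,
   which makes y ^ (u /\ v) periodic as well: the conjugators of y into C* are
   closed under meets. Since some power of D is central, two elements of C* are
   conjugate by a positive u, and y ^ (u /\ D) is again in C*; a minimal simple
   conjugator below u /\ D can thus be split off u, and one concludes by
   induction on the norm of u. *)

(** The orbit of [x] stays in a finite list, so it returns to an earlier point, of index [i].
    Injectivity on [A] cancels these [i] initial steps, so the cycle passes through [x] itself. *)
Lemma iter_fixed_finite {T : eqType} (A : set T) (f : T -> T) (x : T) :
  finite_set A -> (forall y, A y -> A (f y)) ->
  (forall y z, A y -> A z -> f y = f z -> y = z) ->
  A x -> exists2 n, (0 < n)%N & iter n f x = x.
Proof.
case/finite_seqP=> s -> fA f_inj Ax.
have iterA n : iter n f x \in s by elim: n => //= n; apply: fA.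
have: looping f x (size s).
  apply: contraT; rewrite -looping_uniq => traj_uniq.
  have /(uniq_leq_size traj_uniq): {subset traject f x (size s).+1 <= s}.
    by move=> _ /trajectP[i _ ->].
  by rewrite size_traject ltnn.
case/trajectP=> i lt_i_s.
rewrite -(subnKC (ltnW lt_i_s)) iterD => eq_iter.
exists (size s - i)%N; first by rewrite subn_gt0.
have cancel_iter y z : y \in s -> z \in s -> iter i f y = iter i f z -> y = z.
  elim: i {lt_i_s eq_iter} y z => //= j IHj y z ys zs.
  have iterA' w k : w \in s -> iter k f w \in s.
    by move=> ws; elim: k => //= k; apply: fA.
  by move/f_inj=> eqf; apply: IHj => //; apply: eqf; apply: iterA'.
by apply: cancel_iter.
Qed.

Lemma iter_mul_period (T : Type) (f : T -> T) n k (x : T) :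
  iter n f x = x -> iter (k * n) f x = x.
Proof. by move=> fx; elim: k => // k IHk; rewrite mulSn iterD IHk. Qed.

(** * Words in the atoms and bounds on the norm *)

Section GarsideMonoid.
Variables (M : monoidType) (Delta : M).
Hypothesis hM : garside_monoid Delta.
Implicit Types a b c d : M.

(** An upper bound for the norm suffices as an induction measure and avoids computing norms of
    factors. *)
Definition word_bounded n a := forall s, atom_word a s -> (size s <= n)%N.

Lemma atom_word_exists a : exists s, atom_word a s.
Proof. by have [s sA <-] := (garside_atomic hM).1 a; exists s. Qed.

Lemma word_bounded_exists a : exists n, word_bounded n a.
Proof. by have [n [_ nP]] := (garside_atomic hM).2 a; exists n. Qed.

Lemma atom_wordM a b s t :
  atom_word a s -> atom_word b t -> atom_word (a * b) (s ++ t).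
Proof.
move=> [sA <-] [tA <-]; split; last by rewrite big_cat.
by move=> c; rewrite mem_cat => /orP[/sA|/tA].
Qed.

(** An atom word of [a <> 1] is nonempty, so putting it before a word of [b] makes that word
    strictly longer. *)
Lemma word_boundedMl n a b :
  a <> 1 -> word_bounded n (a * b) -> exists2 m, n = m.+1 & word_bounded m b.
Proof.
have [s sw] := atom_word_exists a; case: s sw => [[_]|c s sw _ nab].
  by rewrite big_nil => <-.
have bound t : atom_word b t -> (size t < n)%N.
  move=> tw; apply: leq_trans (nab _ (atom_wordM sw tw)).
  by rewrite size_cat addSn ltnS leq_addl.
have [t /bound] := atom_word_exists b.
by case: n bound {nab} => // n bound _; exists n.
Qed.

Lemma word_boundedMr n a b :
  b <> 1 -> word_bounded n (a * b) -> exists2 m, n = m.+1 & word_bounded m a.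
Proof.
have [s sw] := atom_word_exists b; case: s sw => [[_]|c s sw _ nab].
  by rewrite big_nil => <-.
have bound t : atom_word a t -> (size t < n)%N.
  move=> tw; apply: leq_trans (nab _ (atom_wordM tw sw)).
  by rewrite size_cat /= addnS ltnS leq_addr.
have [t /bound] := atom_word_exists a.
by case: n bound {nab} => // n bound _; exists n.
Qed.

Lemma mulM_eq1 a b : a * b = 1 -> a = 1.
Proof.
move=> ab1; have [n [[w ww <-] w_max]] := (garside_atomic hM).2 1.
have [s sw] := atom_word_exists a; have [t tw] := atom_word_exists b.
(* Appending words of [a] and [b] to a longest word of 1 yields a word of 1 again, so both are
   empty. *)
have := atom_wordM ww (atom_wordM sw tw); rewrite ab1 mul1g => /w_max.
rewrite !size_cat -{2}(addn0 (size w)) leq_add2l leqn0 addn_eq0.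
by case/andP=> /nilP s0 _; case: sw => _ <-; rewrite s0 big_nil.
Qed.

End GarsideMonoid.

(** * The order on the group of fractions and its meets *)

Section GarsideGroup.
Variables (M : monoidType) (G : groupType) (iota : M -> G) (Delta : M).
Hypotheses (hM : garside_monoid Delta) (hG : group_of_fractions iota).
Implicit Types (a b c : M) (g s t u v w x y z : G) (q : int) (m n : nat).

Local Notation D := (iota Delta).
Local Notation "x <<= y" := (prec iota x y) (at level 70).
Local Notation glb := (is_glb (prec iota)).
Local Notation meet := (gmeet iota).
Local Notation Dq q := (expgz D q).
Local Notation cyc q := (cycling iota Delta q).

Definition positive g : Prop := range iota g.

Let iotaM a b : iota (a * b) = iota a * iota b.
Proof. by have [[_ ->]] := hG. Qed.

Let iota1 : iota 1 = 1.
Proof. by have [[->]] := hG. Qed.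

Let iota_inj : injective iota.
Proof. by have [] := hG. Qed.

Lemma fraction g : exists a b, g = (iota a)^-1 * iota b.
Proof. by have [_ _] := hG. Qed.

Lemma positive_iota a : positive (iota a).
Proof. by exists a. Qed.

Lemma positive1 : positive 1.
Proof. by rewrite -iota1; apply: positive_iota. Qed.

Lemma positiveM x y : positive x -> positive y -> positive (x * y).
Proof. by move=> [a _ <-] [b _ <-]; rewrite -iotaM; apply: positive_iota. Qed.

Lemma prec1x x : (1 <<= x) = positive x.
Proof. by rewrite /prec invg1 mul1g. Qed.

Lemma prec_mul2l g x y : (g * x <<= g * y) = (x <<= y).
Proof. by rewrite /prec invgM -mulgA mulKg. Qed.

Lemma prec_mulr x y : positive y -> x <<= x * y.
Proof. by rewrite /prec mulKg. Qed.

Lemma prec_refl x : x <<= x.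
Proof. by rewrite /prec mulVg; apply: positive1. Qed.

Lemma prec_trans y x z : x <<= y -> y <<= z -> x <<= z.
Proof.
by move=> xy yz; rewrite /prec -(mulVKg y z) mulgA; apply: positiveM.
Qed.

Lemma prec_anti x y : x <<= y -> y <<= x -> x = y.
Proof.
rewrite {1}/prec => -[a _ xy] [b _ yx].
have ab1 : a * b = 1.
  by apply: iota_inj; rewrite iotaM iota1 xy yx mulgA mulgK mulVg.
by rewrite -(mulVKg x y) -xy (mulM_eq1 hM ab1) iota1 mulg1.
Qed.

Lemma prec_iota a b : (iota a <<= iota b) <-> ldivides a b.
Proof.
split=> [[c _ eq_c]|[c ->]]; last first.
  by rewrite iotaM; apply/prec_mulr/positive_iota.
by exists c; apply: iota_inj; rewrite iotaM eq_c mulVKg.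
Qed.

Lemma glbP x y z : glb x y z <-> forall t, t <<= z <-> t <<= x /\ t <<= y.
Proof.
split=> [[zx zy z_max] t|zP].
  by split=> [tz|[tx ty]]; [split; apply: prec_trans tz _|apply: z_max].
have [zx zy] := (zP z).1 (prec_refl z).
by split=> // t tx ty; apply/zP.
Qed.

Lemma glb_unique x y z w : glb x y z -> glb x y w -> z = w.
Proof.
move=> [zx zy z_max] [wx wy w_max].
by apply: prec_anti; [apply: w_max|apply: z_max].
Qed.

(** Since [d] divides both multiples, it divides [c']; the cofactor divides [a] and [b], hence [c].
    This keeps a gcd of the monoid greatest among all lower bounds in the group. *)
Lemma ldivides_glbM d a b c c' :
  is_glb (@ldivides M) a b c ->
  is_glb (@ldivides M) (d * a) (d * b) c' -> ldivides c' (d * c).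
Proof.
have ldivMl e a1 b1 : ldivides (e * a1) (e * b1) <-> ldivides a1 b1.
  by rewrite -!prec_iota !iotaM prec_mul2l.
move=> [_ _ c_max] [c'a c'b c'_max].
have [e c'E] : ldivides d c' by apply: c'_max; [exists a|exists b].
by move: c'a c'b; rewrite c'E !ldivMl; apply: c_max.
Qed.

Lemma common_denominator x y :
  exists d a b, iota d * x = iota a /\ iota d * y = iota b.
Proof.
have [a [b xE]] := fraction x; have [c [d yE]] := fraction (iota a * y).
exists (c * a), (c * b), d.
by rewrite !iotaM -!mulgA yE xE !mulVKg.
Qed.

Lemma glb_exists x y : exists z, glb x y z.
Proof.
have [d [a [b [da db]]]] := common_denominator x y.
have [c c_glb] := garside_lgcd hM a b.
have [ca cb _] := c_glb.
exists ((iota d)^-1 * iota c); split; try by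
  rewrite -(prec_mul2l (iota d)) mulVKg ?da ?db; apply/prec_iota.
move=> t tx ty.
(* A lower bound [t] may lie outside the monoid even after multiplication by [d]; a second
   denominator [e] brings it in. *)
have [e [f [_ [ft _]]]] := common_denominator (iota d * t) 1.
rewrite -(prec_mul2l (iota d)) mulVKg -(prec_mul2l (iota e)) ft -iotaM.
have [c' c'_glb] := garside_lgcd hM (e * a) (e * b).
apply/(prec_trans (y := iota c')); last exact/prec_iota/(ldivides_glbM c_glb).
have [_ _ c'_max] := c'_glb.
apply/prec_iota/c'_max; apply/prec_iota;
  by rewrite iotaM -?ft -?da -?db !prec_mul2l.
Qed.

Lemma gmeetP x y : glb x y (meet x y).
Proof. exact: (xgetPex 1 (glb_exists x y)). Qed.

Lemma prec_gmeet x y t : (t <<= meet x y) <-> t <<= x /\ t <<= y.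
Proof. by move: t; apply/glbP/gmeetP. Qed.

Lemma gmeet_mul2l g x y : g * meet x y = meet (g * x) (g * y).
Proof.
apply: (glb_unique (x := g * x) (y := g * y)); last exact: gmeetP.
by apply/glbP => t; rewrite -(mulVKg g t) !prec_mul2l prec_gmeet.
Qed.

(** * Simple elements and conjugation by the Garside element *)

Lemma delta_positive : positive D. Proof. exact: positive_iota. Qed.

Lemma simplesP s : simples iota Delta s <-> positive s /\ s <<= D.
Proof.
split=> [[a aD <-]|[[a _ <-] aD]].
  by split; [apply: positive_iota|apply/prec_iota].
by exists a => //; apply/prec_iota.
Qed.

Lemma simples_delta s : simples iota Delta s -> simples iota Delta (s ^ D).
Proof.
move=> [a aD <-]; have [aDP _ _] := garside_delta hM.
have [b DE] := aD.
have [c DE'] : ldivides b Delta by apply/aDP; exists a.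
(* From [Delta = a * b = b * c] one gets [a * Delta = Delta * c]. *)
suff <- : iota c = iota a ^ D.
  by exists c => //; apply/aDP; exists b.
apply: (mulgI D); rewrite -conjgC -!iotaM; congr iota.
by rewrite {1}DE -mulgA -DE'.
Qed.

Lemma simples_deltaV s : simples iota Delta s -> simples iota Delta (s ^ D^-1).
Proof.
move=> [a aD <-]; have [aDP _ _] := garside_delta hM.
have [b DE] := (aDP a).1 aD.
have [c DE'] : rdivides b Delta by apply/aDP; exists a.
suff <- : iota c = iota a ^ D^-1.
  by exists c => //; exists b.
apply: (mulIg D); rewrite -conjgCV -!iotaM; congr iota.
by rewrite {1}DE mulgA -DE'.
Qed.

Lemma positive_ind (P : G -> Prop) :
  P 1 -> (forall s g, simples iota Delta s -> P g -> P (s * g)) ->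
  forall g, positive g -> P g.
Proof.
move=> P1 PM _ [a _ <-]; have [_ _ /(_ a)] := garside_delta hM.
case=> w wS <-; elim: w wS => [|s w IHw] wS; first by rewrite big_nil iota1.
rewrite big_cons iotaM; apply: PM.
  by exists s => //; apply: wS; rewrite mem_head.
by apply: IHw => b bw; apply: wS; rewrite inE bw orbT.
Qed.

Lemma simples_positive s : simples iota Delta s -> positive s.
Proof. by case/simplesP. Qed.

Lemma positive_delta g : positive (g ^ D) <-> positive g.
Proof.
split=> [|]; last first.
  elim/positive_ind => [|s {}g /simples_delta/simples_positive s_pos g_pos].
    by rewrite conj1g; apply: positive1.
  by rewrite conjMg; apply: positiveM.
rewrite -{2}(conjgK D g).
elim/positive_ind => [|s h /simples_deltaV/simples_positive s_pos h_pos].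
  by rewrite conj1g; apply: positive1.
by rewrite conjMg; apply: positiveM.
Qed.

(** The order is left invariant, so right multiplication by [D] acts on it as conjugation by [D],
    which preserves positivity in both directions. *)
Lemma prec_mulr_delta x y : (x * D <<= y * D) <-> x <<= y.
Proof.
have -> : (x * D <<= y * D) = positive ((x^-1 * y) ^ D).
  by rewrite /prec invgM conjgE !mulgA.
exact: positive_delta.
Qed.

Lemma prec_mulrX n x y : (x * D ^+ n <<= y * D ^+ n) <-> x <<= y.
Proof.
elim: n => [|n IHn]; first by rewrite !mulg1.
by rewrite expgSr !mulgA prec_mulr_delta.
Qed.

Lemma prec_mulrZ q x y : (x * Dq q <<= y * Dq q) <-> x <<= y.
Proof.
case: q => n /=; first exact: prec_mulrX.
by rewrite -(prec_mulrX n.+1) !mulgVK.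
Qed.

Lemma commute_delta q : commute D (Dq q).
Proof.
case: q => n; first exact: commuteX.
by apply: commuteV; apply: commuteX.
Qed.

Lemma gmeet_mulrZ q x y : meet x y * Dq q = meet (x * Dq q) (y * Dq q).
Proof.
apply: (glb_unique (x := x * Dq q) (y := y * Dq q)); last exact: gmeetP.
by apply/glbP => t; rewrite -(mulgVK (Dq q) t) !prec_mulrZ prec_gmeet.
Qed.

(** * Transport of conjugators along cycling *)

Definition transport q y u : G :=
  (meet y (Dq q))^-1 * (u * meet (y ^ u) (Dq q)).

Lemma transportE q y u :
  transport q y u = (meet y (Dq q))^-1 * meet (y * u) (u * Dq q).
Proof. by rewrite /transport gmeet_mul2l -conjgC. Qed.

Lemma cycling_transport q y u : cyc q (y ^ u) = cyc q y ^ transport q y u.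
Proof. by rewrite /cycling /transport -!conjgM mulVKg. Qed.

Lemma transport_delta q y n : transport q y (D ^+ n) = D ^+ n.
Proof.
have DnC : commute (Dq q) (D ^+ n) by apply/commuteX/commute_sym/commute_delta.
by rewrite transportE -DnC -(gmeet_mulrZ n) mulKg.
Qed.

Lemma transport_glb q y u v w :
  glb u v w -> glb (transport q y u) (transport q y v) (transport q y w).
Proof.
move=> /glbP wP; apply/glbP => t.
rewrite -(mulKg (meet y (Dq q)) t) !transportE !prec_mul2l !prec_gmeet.
move: (_ * t) => r.
(* Left multiplication by [y] and right multiplication by [Dq q] are order automorphisms, so the
   bounds on [r] become bounds by [u], [v] and [w] alone. *)
have precl g : (r <<= y * g) = (y^-1 * r <<= g).
  by rewrite -[RHS](prec_mul2l y) mulVKg.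
have precr g : (r <<= g * Dq q) <-> (r / Dq q <<= g).
  by rewrite -(prec_mulrZ q (r / Dq q)) mulgVK.
rewrite !precl !precr !wP; tauto.
Qed.

Fixpoint itransport q n y u : G :=
  if n is m.+1 then itransport q m (cyc q y) (transport q y u) else u.

Lemma itransportD q m n y u :
  itransport q (m + n) y u =
    itransport q n (iter m (cyc q) y) (itransport q m y u).
Proof. by elim: m y u => //= m IHm y u; rewrite IHm -iterSr. Qed.

Lemma iter_cycling_itransport q n y u :
  iter n (cyc q) (y ^ u) = iter n (cyc q) y ^ itransport q n y u.
Proof.
elim: n y u => // n IHn y u.
by rewrite !iterSr cycling_transport IHn.
Qed.

Lemma itransport_delta q n y m : itransport q n y (D ^+ m) = D ^+ m.
Proof. by elim: n y => //= n IHn y; rewrite transport_delta. Qed.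

Lemma itransport_glb q n y u v w :
  glb u v w ->
  glb (itransport q n y u) (itransport q n y v) (itransport q n y w).
Proof. by elim: n y u v w => //= n IHn y u v w /(transport_glb q y)/IHn. Qed.

(** Expressing the order by meets makes monotonicity of transport a case of preservation of
    meets. *)
Lemma glb_prec x y : x <<= y <-> glb x y x.
Proof. by split=> [xy|[]//]; split=> //; apply: prec_refl. Qed.

Lemma itransport_prec q n y u v :
  u <<= v -> itransport q n y u <<= itransport q n y v.
Proof. by rewrite !glb_prec; apply: itransport_glb. Qed.

(* With the conjugate y ^ u = y ^ v fixed, transport multiplies on both sides by
   fixed elements. *)
Lemma itransport_inj q n y u v :
  y ^ u = y ^ v -> itransport q n y u = itransport q n y v -> u = v.
Proof.
elim: n y u v => //= n IHn y u v yuv eqT.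
have: transport q y u = transport q y v.
  by apply: IHn eqT; rewrite -!cycling_transport yuv.
by rewrite /transport yuv => /mulgI/mulIg.
Qed.

Lemma itransport_iter q N y u k :
  iter N (cyc q) y = y ->
  itransport q (k * N) y u = iter k (itransport q N y) u.
Proof.
move=> yN; elim: k => // k IHk.
rewrite mulSnr itransportD IHk /=; congr itransport.
by elim: k {IHk} => // k IHk; rewrite mulSn iterD IHk.
Qed.

(** * Finite intervals and periodicity of transport *)

Lemma simples_finite : finite_set (simples iota Delta).
Proof. by apply: finite_image; have [] := garside_delta hM. Qed.

Lemma deltaX_positive n : positive (D ^+ n).
Proof.
elim: n => [|n IHn]; first exact: positive1.
by rewrite expgS; apply: positiveM => //; apply: delta_positive.
Qed.

Lemma meet_simples u : positive u -> simples iota Delta (meet u D).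
Proof.
by move=> u_pos; apply/simplesP; have [_ uD _] := gmeetP u D;
  rewrite -{1}prec1x prec_gmeet !prec1x; split=> //; split=> //; apply: delta_positive.
Qed.

Lemma finite_interval m :
  finite_set [set u | positive u /\ u <<= D ^+ m]%classic.
Proof.
elim: m => [|m IHm].
  apply: (@sub_finite_set _ _ [set 1]%classic); last exact: finite_set1.
  by move=> u /= [u_pos u1]; apply: prec_anti => //; rewrite prec1x.
apply: sub_finite_set (finite_image2 mul simples_finite IHm).
move=> u /= [u_pos uD]; exists (meet u D); first exact: meet_simples.
have [mu _ _] := gmeetP u D.
(* The cofactor lies below [D ^+ m]: [u] precedes both [u * D ^+ m] and [D ^+ m.+1], hence their
   meet [meet u D * D ^+ m]. *)
exists ((meet u D)^-1 * u); last by rewrite mulVKg.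
split=> //; rewrite -(prec_mul2l (meet u D)) mulVKg.
rewrite -[D ^+ m]/(expgz D (Posz m)) gmeet_mulrZ prec_gmeet /= -expgS; split=> //.
exact/prec_mulr/deltaX_positive.
Qed.

Lemma itransport_period q y u m :
  periodic iota Delta q y -> periodic iota Delta q (y ^ u) ->
  positive u -> u <<= D ^+ m ->
  exists2 N, (0 < N)%N & iter N (cyc q) y = y /\ itransport q N y u = u.
Proof.
move=> [N1 N1_gt0 yN1] [N2 N2_gt0 yuN2] u_pos uD.
pose N := (N2 * N1)%N.
have yN : iter N (cyc q) y = y by apply: iter_mul_period.
have yuN : iter N (cyc q) (y ^ u) = y ^ u.
  by rewrite /N mulnC; apply: iter_mul_period.
(* Fixing the conjugate [y ^ v] makes the iterated transport injective on [A]. It stays in the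
   interval because it is monotone and fixes both ends. *)
pose A := [set v | (positive v /\ v <<= D ^+ m) /\ y ^ v = y ^ u]%classic.
have [k k_gt0 uk] : exists2 k, (0 < k)%N & iter k (itransport q N y) u = u.
  apply: (@iter_fixed_finite _ A) => //.
  - by apply: sub_finite_set (finite_interval m) => v [].
  - move=> v [[v_pos vD] yv]; split; last first.
      by rewrite -{1}yN -iter_cycling_itransport yv.
    split; last by rewrite -(itransport_delta q N y); apply: itransport_prec.
    (* The lower end 1 is [D ^+ 0], hence fixed by transport. *)
    rewrite -prec1x -[1](itransport_delta q N y 0).
    by apply: itransport_prec; rewrite prec1x.
  by move=> v w [_ yv] [_ yw]; apply: itransport_inj; rewrite yv yw.
exists (k * N)%N; first by rewrite !muln_gt0 k_gt0 N2_gt0.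
by split; [apply: iter_mul_period|rewrite itransport_iter].
Qed.

Lemma periodic_glb q y u v w m :
  periodic iota Delta q y ->
  periodic iota Delta q (y ^ u) -> periodic iota Delta q (y ^ v) ->
  positive u -> u <<= D ^+ m -> positive v -> v <<= D ^+ m ->
  glb u v w -> periodic iota Delta q (y ^ w).
Proof.
move=> yP yuP yvP u_pos uD v_pos vD w_glb.
have [K K_gt0 [yK uK]] := itransport_period yP yuP u_pos uD.
have [L L_gt0 [yL vL]] := itransport_period yP yvP v_pos vD.
exists (L * K)%N; first by rewrite muln_gt0 L_gt0.
have yLK : iter (L * K) (cyc q) y = y by apply: iter_mul_period.
rewrite iter_cycling_itransport yLK; congr (y ^ _).
(* After [L * K] steps [u] and [v] are both back in place, so the transport of [w] is again their
   meet. *)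
apply: (glb_unique _ w_glb); have := itransport_glb q (L * K) y w_glb.
rewrite {1}(itransport_iter _ _ yK) iter_fix // mulnC.
by rewrite (itransport_iter _ _ yL) iter_fix.
Qed.

(** * Meets of conjugators into the fully refined summit set *)

Lemma Cstar_conj x y u :
  Cstar iota Delta x y ->
  Cstar iota Delta y (y ^ u) <-> Cstar iota Delta x (y ^ u).
Proof.
case=> [[v ->]] _; split=> -[[w xw] per]; split=> //.
  by exists (v * u); rewrite conjgM.
by exists u.
Qed.

Lemma Cstar_periodic x y q : Cstar iota Delta x y -> periodic iota Delta q y.
Proof. by case=> _ /(_ q I). Qed.

Lemma Cstar_delta x y : Cstar iota Delta x y -> Cstar iota Delta x (y ^ D).
Proof.
move=> yC; apply/(Cstar_conj _ yC); split; first by exists D.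
move=> q _; have [N N_gt0 yN] := Cstar_periodic q yC; exists N => //.
by rewrite iter_cycling_itransport -[X in itransport _ _ _ X]expg1 itransport_delta yN.
Qed.

Lemma positive_prec_deltaX u : positive u -> exists m, u <<= D ^+ m.
Proof.
elim/positive_ind => [|s g sS [m gD]]; first by exists 0%N; apply: prec_refl.
exists m.+1; apply: (prec_trans (y := s * D ^+ m)); first by rewrite prec_mul2l.
by rewrite expgS prec_mulrX; case/simplesP: sS.
Qed.

(** If [u] precedes [D ^+ m.+1], it precedes [meet u D * D ^+ m = D ^+ m]; repeating this brings [u]
    below 1. *)
Lemma meet_delta_eq1 u : positive u -> meet u D = 1 -> u = 1.
Proof.
move=> u_pos m1; have [m] := positive_prec_deltaX u_pos.
elim: m => [|m IHm] uD; first by apply: prec_anti; rewrite ?prec1x.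
apply: IHm; rewrite -[D ^+ m]mul1g -m1 -[D ^+ m]/(expgz D (Posz m)).
rewrite gmeet_mulrZ prec_gmeet /= -expgS; split=> //.
exact/prec_mulr/deltaX_positive.
Qed.

Lemma Cstar_meet_delta x y u :
  Cstar iota Delta x y -> Cstar iota Delta x (y ^ u) -> positive u ->
  Cstar iota Delta x (y ^ meet u D).
Proof.
move=> yC yuC u_pos; apply/(Cstar_conj _ yC); split; first by eexists.
move=> q _; have [m uDm] := positive_prec_deltaX u_pos.
have Dle n : D ^+ n <<= D ^+ n.+1.
  by rewrite expgSr; apply: prec_mulr; apply: delta_positive.
(* The exponent [m.+1] bounds both [u] and [D], even when [m] is 0. *)
apply: (periodic_glb (m := m.+1) _ _ _ u_pos _ delta_positive _ (gmeetP u D)).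
- exact: Cstar_periodic yC.
- exact: Cstar_periodic yuC.
- exact: Cstar_periodic (Cstar_delta yC).
- exact: prec_trans uDm (Dle m).
by rewrite expgS; apply/prec_mulr/deltaX_positive.
Qed.

(** * A central power of the Garside element and positive conjugators *)

Lemma deltaX_central : exists2 e, (0 < e)%N & forall g, commute (D ^+ e) g.
Proof.
have period s : simples iota Delta s ->
    exists2 n, (0 < n)%N & iter n (conjg^~ D) s = s.
  move=> sS; apply: (iter_fixed_finite simples_finite) => //.
    exact: simples_delta.
  by move=> y z _ _; apply: conjg_inj.
(* A common period of all simples is built as a product of their individual periods. *)
have [e e_gt0 eP] : exists2 e, (0 < e)%N &
    forall s, simples iota Delta s -> iter e (conjg^~ D) s = s.
  have /finite_seqP[r rE] := simples_finite.
  have rS s : s \in r -> simples iota Delta s by rewrite rE.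
  suff [e e_gt0 eP] : exists2 e, (0 < e)%N &
      forall s, s \in r -> iter e (conjg^~ D) s = s.
    by exists e => // s; rewrite rE; apply: eP.
  elim: r {rE} rS => [|s r IHr] rS; first by exists 1%N.
  have [|e e_gt0 eP] := IHr; first by move=> t tr; apply: rS; rewrite inE tr orbT.
  have [n n_gt0 sn] := period s (rS s (mem_head s r)).
  exists (n * e)%N; first by rewrite muln_gt0 n_gt0.
  move=> t; rewrite inE => /orP[/eqP->|/eP te]; last exact: iter_mul_period.
  by rewrite mulnC; apply: iter_mul_period.
have iter_conj n s : iter n (conjg^~ D) s = s ^ (D ^+ n).
  by elim: n => [|n IHn]; rewrite ?conjg1 // expgSr conjgM -IHn.
exists e => // g.
have pos_comm h : positive h -> commute (D ^+ e) h.
  elim/positive_ind => [|s {}h /eP sD hD]; first exact: commute1.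
  apply: commuteM => //; apply: commute_sym.
  by rewrite /commute conjgC -iter_conj sD.
have [a [b ->]] := fraction g.
by apply: commuteM; [apply: commuteV|]; apply/pos_comm/positive_iota.
Qed.

(** Write [u] as a left fraction with denominator [a]. A central power of [D] that [a] divides
    clears the denominator and leaves the conjugate unchanged. *)
Lemma positive_conjugator x u : exists2 v, positive v & x ^ v = x ^ u.
Proof.
have [e e_gt0 eC] := deltaX_central.
have [a [b uE]] := fraction u.
have [m aD] := positive_prec_deltaX (positive_iota a).
exists (D ^+ (e * m) * u); last first.
  have comm : commute (D ^+ (e * m)) x.
    by rewrite expgnA; apply/commute_sym/commuteX/commute_sym.
  by rewrite conjgM [x ^ (D ^+ _)]conjgE -comm mulKg.
rewrite uE mulgA expgnA; have -> : D ^+ e ^+ m / iota a = (iota a)^-1 * D ^+ e ^+ m.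
  by apply/commute_sym/commuteX/commute_sym.
apply: positiveM (positive_iota b).
suff: iota a <<= D ^+ (e * m) by rewrite expgnA.
apply: prec_trans aD _.
by rewrite -(prednK e_gt0) mulSn expgnDr; apply/prec_mulr/deltaX_positive.
Qed.

(** * Induction on the norm and construction of the chain *)

Definition norm_bounded n g := exists2 a, iota a = g & word_bounded n a.

Lemma norm_boundedMl n u v : positive u -> positive v -> u <> 1 ->
  norm_bounded n (u * v) -> exists2 m, n = m.+1 & norm_bounded m v.
Proof.
move=> [a _ <-] [b _ <-] a1 [c]; rewrite -iotaM => /iota_inj-> abn.
have [|m -> bm] := word_boundedMl hM _ abn; last by exists m => //; exists b.
by move=> a1'; apply: a1; rewrite a1'.
Qed.

Lemma norm_boundedMr n u v : positive u -> positive v -> v <> 1 ->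
  norm_bounded n (u * v) -> exists2 m, n = m.+1 & norm_bounded m u.
Proof.
move=> [a _ <-] [b _ <-] b1 [c]; rewrite -iotaM => /iota_inj-> abn.
have [|m -> am] := word_boundedMr hM _ abn; last by exists m => //; exists a.
by move=> b1'; apply: b1; rewrite b1'.
Qed.

Lemma norm_bounded_exists u : positive u -> exists n, norm_bounded n u.
Proof.
by move=> [a _ <-]; have [n] := word_bounded_exists hM a; exists n, a.
Qed.

(** Passing from [u] to a smaller [v] in [B] removes a nontrivial positive right factor, so the norm
    bound drops and the descent ends. *)
Lemma minimal_below (B : set G) u :
  (forall v, B v -> positive v) -> B u ->
  exists2 v, minimal_in iota B v & v <<= u.
Proof.
move=> B_pos Bu; have [n] := norm_bounded_exists (B_pos u Bu).
have [k] := ubnP n; elim: k => // k IHk in n u Bu *; rewrite ltnS => le_nk nu.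
apply: contrapT => u_min.
have [v [Bv vu vNu]] : exists v, [/\ B v, v <<= u & v <> u].
  apply: contrapT => no_v; apply: u_min; exists u; last exact: prec_refl.
  by split=> // v Bv vu; apply: contrapT => vNu; apply: no_v; exists v.
have [||||m nE mv] := @norm_boundedMr n v (v^-1 * u); rewrite ?mulVKg //.
- exact: B_pos.
- by move=> vu1; apply: vNu; rewrite -(mulVKg v u) vu1 mulg1.
apply: u_min; have [|w w_min wv] := IHk m v Bv _ mv; first by rewrite -nE.
by exists w => //; apply: prec_trans wv vu.
Qed.

Lemma Cstar_chain_positive x y u :
  Cstar iota Delta x y -> Cstar iota Delta x (y ^ u) -> positive u ->
  exists (k : nat) (c : nat -> G),
    [/\ (1 <= k)%N, c 1%N = y, c k = y ^ u,
        (forall i : nat, (1 <= i <= k)%N -> Cstar iota Delta x (c i)) &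
        (forall i : nat, (1 <= i < k)%N ->
           exists2 s : G, Amin iota Delta (c i) s & c i.+1 = c i ^ s)].
Proof.
move=> yC yuC u_pos; have [n] := norm_bounded_exists u_pos.
have [N] := ubnP n; elim: N => // N IHN in n y u yC yuC u_pos *.
rewrite ltnS => le_nN nu.
have [u1|u1] := pselect (u = 1).
  exists 1%N, (fun=> y); split=> // [|i]; first by rewrite u1 conjg1.
  by case: i => [|[]].
pose B := [set s | [/\ simples iota Delta s, s <> 1 &
                      Cstar iota Delta y (y ^ s)]]%classic.
have [mu _ _] := gmeetP u D.
have Bm : B (meet u D).
  split; first exact: meet_simples.
    by move/(meet_delta_eq1 u_pos).
  by apply/(Cstar_conj _ yC)/Cstar_meet_delta.
have [|s s_min sm] := minimal_below _ Bm.
  by move=> s [/simples_positive].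
have [[/simples_positive s_pos s1 /(Cstar_conj _ yC) ysC] _] := s_min.
(* As [s] precedes [meet u D], it splits off [u] on the left; being nontrivial, it lowers the norm
   bound. *)
have [|m nE mv] := @norm_boundedMl n s (s^-1 * u) s_pos (prec_trans sm mu) s1.
  by rewrite mulVKg.
have := IHN m (y ^ s) (s^-1 * u) ysC.
rewrite -conjgM mulVKg => /(_ yuC (prec_trans sm mu) _ mv).
case=> [|k [c [k_gt0 c1 ck cC cA]]]; first by rewrite -nE.
(* Chains start at index 1, so prepending [y] shifts [c] by one and the value at 0 is a dummy. *)
exists k.+1, (fun i => if i is j.+2 then c j.+1 else y); split=> //.
- by case: (k) k_gt0 ck.
- by move=> [|[|i]] //; apply: (cC i.+1).
move=> [|[|i]] // lt_ik; last exact: (cA i.+1).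
by exists s.
Qed.

End GarsideGroup.

Theorem theorem3p6 (M : monoidType) (G : groupType) (iota : M -> G) (Delta : M)
    (hM : garside_monoid Delta) (hG : group_of_fractions iota)
    (x x1 x2 : G) (hx1 : Cstar iota Delta x x1) (hx2 : Cstar iota Delta x x2) :
  exists (k : nat) (y : nat -> G),
    [/\ (1 <= k)%N,
        y 1%N = x1,
        y k = x2,
        (forall i : nat, (1 <= i <= k)%N -> Cstar iota Delta x (y i)) &
        (forall i : nat, (1 <= i < k)%N ->
           exists2 u : G, Amin iota Delta (y i) u & y i.+1 = y i ^ u)].
Proof.
have [[u1 x1E] _] := hx1; have [[u2 x2E] _] := hx2.
(* [u1^-1 * u2] conjugates [x1] to [x2] by way of [x]; it is then replaced by a positive
   conjugator. *)
have [u u_pos x2E'] := positive_conjugator hM hG x1 (u1^-1 * u2).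
have {x2E'}x2E' : x2 = x1 ^ u by rewrite x2E' x1E x2E conjgM conjgK.
move: hx2; rewrite x2E' => hx2'.
by apply: (Cstar_chain_positive hM hG hx1 hx2').
Qed.
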